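(* Let $\mathbb{F}$ be a field with $|\mathbb{F}|\geq 3$, let $A\in M_n(\mathbb{F})$, let $\mathcal{B}$ be a linear subspace of $M_n(\mathbb{F})$ contained in $W_n(\mathbb{F})$, and let $\mathcal{S}=A+\mathcal{B}$. If $\rho(\mathcal{S})=k$ then $\dim\mathcal{S}\le u_s(n,k)$, where $u_s(n,k)=\max\{\binom{2t+1}{2},\, tn-\binom{t}{2}\}$ if $k=2t$, and $u_s(n,k)=\max\{\binom{2t+2}{2},\, tn-\binom{t}{2}+1\}$ if $k=2t+1$.
   Context: $M_n(\mathbb{F})$ is the space of $n\times n$ matrices over $\mathbb{F}$. A matrix $A=(A(i,j))$ is weakly symmetric if for all $i,j$: $A(i,j)\neq0$ iff $A(j,i)\neq 0$; $W_n(\mathbb{F})$ is the set of weakly symmetric matrices in $M_n(\mathbb{F})$. For a set $\mathcal{S}$ of matrices, $\rho(\mathcal{S})=\max\{\mathrm{rk}(A):A\in\mathcal{S}\}$. The dimension of $\mathcal{S}=A+\mathcal{B}$ is $\dim\mathcal{B}$. *)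

(* Defs.v *)
From HB Require Import structures.
From mathcomp Require Import all_boot all_order all_algebra.
Set Implicit Arguments.
Unset Strict Implicit.
Unset Printing Implicit Defensive.
Import GRing.Theory.
Local Open Scope ring_scope.

Definition weakly_symmetric (F : fieldType) (n : nat) (A : 'M[F]_n) : Prop :=
  forall i j : 'I_n, A i j != 0 <-> A j i != 0.

(* The affine space A + B; its dimension is by definition \dim B. *)
Definition affine_space (F : fieldType) (n : nat) (A : 'M[F]_n)
    (B : {vspace 'M[F]_n}) (M : 'M[F]_n) : Prop :=
  exists2 X : 'M[F]_n, X \in B & M = A + X.

(* rho(S) = k: the maximum is stated relationally, as attained upper bound. *)
Definition max_rank_eq (F : fieldType) (n : nat) (S : 'M[F]_n -> Prop)
    (k : nat) : Prop :=
  (exists2 M : 'M[F]_n, S M & \rank M = k) /\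
  (forall M : 'M[F]_n, S M -> (\rank M <= k)%N).

(* The natural subtraction t * n - 'C(t, 2) does not truncate when t <= n,
   hence in particular whenever k is a rank of an n x n matrix. *)
Definition u_s (n k : nat) : nat :=
  (let t := k./2 in
   if odd k then maxn 'C(2 * t + 2, 2) (t * n - 'C(t, 2) + 1)
   else maxn 'C(2 * t + 1, 2) (t * n - 'C(t, 2)))%N.

(* Main.v *)
(** Give the position [(i, j)] the weight [2 ^ i + 2 ^ j], which determines [{i, j}].
    The positions of the entries of maximal weight of the nonzero matrices of [B] form
    a graph with loops on ['I_n] with at least [\dim B] edges.  Suppose that disjoint
    edges and loops of this graph cover the set [C], take the matrices [X_l] of [B]
    that they lead, and consider the minor on [C] of [A + \sum_l x_l X_l].  Since the
    weights add up, its monomial in which edges have exponent 2 and loops exponent 1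
    has as coefficient the product of the leading entries, up to sign.  This monomial
    has top degree, so three values for each variable suffice to find a point where
    the minor does not vanish, whence [#|C| <= k].

    It remains to bound the number of edges of a graph with loops whose matchings
    cover at most [k] vertices.  If deleting some vertex decreases this maximum by 2,
    delete it and induct.  Otherwise, by an alternating path argument, there are at
    most ['C(k + 1, 2)] edges.  With [a] deletions this gives the bound
    [a n - 'C(a, 2) + 'C(k + 1 - 2 a, 2)], which is convex in [a]. *)

Require Import Defs.
From mathcomp Require Import all_boot all_order all_algebra.
From mathcomp Require Import perm zify.
Set Implicit Arguments.
Unset Strict Implicit.
Unset Printing Implicit Defensive.
Import Order.TTheory GRing.Theory.

Section PairOfInvolutions.
Variables (T : finType) (s t : T -> T) (v : T).
Hypotheses (sK : involutive s) (tK : involutive t) (sv : s v = v).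

Local Notation f := (s \o t).

Lemma comp_involutions_inj : injective f.
Proof. exact: inj_comp (inv_inj sK) (inv_inj tK). Qed.

Lemma iter_comp_involutionsK i : iter i f (s (iter i f v)) = v.
Proof. by elim: i => // i IHi; rewrite iterSr /= sK tK. Qed.

Lemma order_involution_fixpoint i :
  i < order f v -> t (iter i f v) = iter i f v -> order f v = i.*2.+1.
Proof.
move=> lti fixt; have aperiodic q : 0 < q < order f v -> iter q f v <> v.
  case/andP=> q_gt0 /findex_iter + fixq.
  by rewrite fixq findex0 => q0; rewrite -q0 in q_gt0.
have fixv : iter i.*2.+1 f v = v.
  rewrite -addnn -addSn iterD -fixt -[in RHS](iter_comp_involutionsK i.+1).
  by rewrite /= sK.
have [lt_order|gt_order|//] := ltngtP (order f v) i.*2.+1.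
  case: (aperiodic (i.*2.+1 - order f v)); first by lia.
  rewrite -[v in iter _ _ v](iter_order comp_involutions_inj) -iterD subnK //.
  exact: ltnW.
by case: (aperiodic i.*2.+1).
Qed.

(* In the union of two matchings the component of a vertex missed by the first
   one is an alternating path: the second one misses at most one vertex of it. *)
Lemma exists_stable_unique_fixpoint :
  exists Q : {set T}, [/\ v \in Q, {in Q, forall x, s x \in Q},
    {in Q, forall x, t x \in Q}
    & {in Q &, forall x y, t x = x -> t y = y -> x = y}].
Proof.
pose Q := [set x | fconnect f v x].
have iterQ i : iter i f v \in Q by rewrite inE fconnect_iter.
have QP x : x \in Q -> exists2 i, i < order f v & x = iter i f v.
  rewrite inE => vx; exists (findex f v x); first exact: findex_max.
  by rewrite iter_findex.
have sQ : {in Q, forall x, s x \in Q}.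
  move=> _ /QP[i _ ->]; rewrite inE (fconnect_sym comp_involutions_inj).
  by rewrite -[X in fconnect f _ X](iter_comp_involutionsK i) fconnect_iter.
exists Q; split=> //; first exact: (iterQ 0).
- by move=> _ /QP[i _ ->]; have := sQ _ (iterQ i.+1); rewrite /= sK.
- move=> _ _ /QP[i lti ->] /QP[j ltj ->].
  move=> /(order_involution_fixpoint lti) orderE /(order_involution_fixpoint ltj).
  by rewrite orderE => -[/double_inj->].
Qed.

End PairOfInvolutions.

Lemma set2_inj (T : finType) (a b c d : T) :
  [set a; b] = [set c; d] -> (a = c /\ b = d) \/ (a = d /\ b = c).
Proof.
move=> eq_set2; have /set2P ac : a \in [set c; d] by rewrite -eq_set2 set21.
have /set2P bc : b \in [set c; d] by rewrite -eq_set2 set22.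
have /set2P ca : c \in [set a; b] by rewrite eq_set2 set21.
have /set2P da : d \in [set a; b] by rewrite eq_set2 set22.
by case: ac bc ca da => -> [] -> [] ? [] ?; subst; auto.
Qed.

Section Matchings.
Variables (T : finType) (e : rel T).
Implicit Types (x y z v : T) (C D Q p : {set T}) (m : T -> T).

(* A set of disjoint edges and loops covering [C] is encoded by the involution
   that swaps the ends of each of them. *)
Definition matching m C : Prop :=
  [/\ involutive m, {in C, forall x, e x (m x)} & {in ~: C, m =1 id}].

Definition matchable C : bool :=
  [exists m : {ffun T -> T},
    [forall x, (m (m x) == x) && (if x \in C then e x (m x) else m x == x)]].

(* The maximum matchable sets are the bases of the matching matroid of [e]. *)
Definition matching_rank : nat := \max_(C | matchable C) #|C|.

Definition basis C : bool := matchable C && (#|C| == matching_rank).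

Definition edges : {set {set T}} := [set [set x; y] | x in T, y in e x].

Definition essential v : bool :=
  [forall (C | matchable C && (v \notin C)), #|C|.+2 <= matching_rank].

Lemma matchableP C : reflect (exists m, matching m C) (matchable C).
Proof.
apply: (iffP existsP) => [[m /forallP mP] | [m [mK mC mN]]].
  exists m; split=> [x|x xC|x /setCP/negP xC]; have /andP[/eqP //] := mP x.
    by rewrite xC.
  by rewrite (negPf xC) => _ /eqP.
exists (finfun m); apply/forallP => x; rewrite !ffunE mK eqxx /=.
by case: ifPn => [/mC | xC] //; rewrite mN ?eqxx // inE.
Qed.

Lemma matchable0 : matchable set0.
Proof. by apply/matchableP; exists id; split=> // x; rewrite inE. Qed.

Lemma leq_matching_rank C : matchable C -> #|C| <= matching_rank.
Proof. exact: leq_bigmax_cond. Qed.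

Lemma basis_exists : exists C, basis C.
Proof.
have [|C mC rkC] := @eq_bigmax_cond _ matchable (fun C : {set T} => #|C|).
  by apply/card_gt0P; exists set0; apply: matchable0.
by exists C; rewrite /basis /matching_rank rkC eqxx andbT.
Qed.

Lemma edgesP p : reflect (exists2 xy, e xy.1 xy.2 & p = [set xy.1; xy.2])
                         (p \in edges).
Proof.
apply: (iffP imset2P) => [[x y _ exy ->] | [[x y] exy ->]].
  by exists (x, y).
by exists x y.
Qed.

Lemma essential_mem_basis v C : essential v -> basis C -> v \in C.
Proof.
move=> /forall_inP ess /andP[mC /eqP rkC]; apply: contraT => vC.
by have := ess C; rewrite mC vC -rkC => /(_ isT); lia.
Qed.

Lemma matching_mem m C x : matching m C -> (m x \in C) = (x \in C).
Proof.
case=> mK mC mN; apply/idP/idP; apply: contraTT => xC.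
  by rewrite mN ?inE.
by rewrite -[x]mK mN ?inE.
Qed.

Lemma matchable_glue m1 m2 C1 C2 Q :
  matching m1 C1 -> matching m2 C2 ->
  {in Q, forall x, m1 x \in Q} -> {in Q, forall x, m2 x \in Q} ->
  matchable ((C1 :&: Q) :|: (C2 :\: Q)).
Proof.
case=> m1K m1C m1N [m2K m2C m2N] stable1 stable2; apply/matchableP.
exists (fun x => if x \in Q then m1 x else m2 x); split=> x.
- have [xQ | xQ] := boolP (x \in Q); first by rewrite stable1.
  by case: ifP => [/stable2|//]; rewrite m2K (negPf xQ).
- rewrite !inE; case: (x \in Q); rewrite ?andbT ?andbF ?orbF /=.
    exact: m1C.
  exact: m2C.
- rewrite !inE; case: (x \in Q); rewrite ?andbT ?andbF ?orbF /= => xC.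
    by rewrite m1N ?inE.
  by rewrite m2N ?inE.
Qed.

Hypothesis e_sym : symmetric e.

Lemma mem_edges x y : ([set x; y] \in edges) = e x y.
Proof.
apply/edgesP/idP => [[[a b] /= eab /set2_inj[[-> ->] | [-> ->]]] | exy] //.
  by rewrite e_sym.
by exists (x, y).
Qed.

Lemma matchableU2 C x y :
  matchable C -> x \notin C -> y \notin C -> e x y ->
  matchable ([set x; y] :|: C).
Proof.
case/matchableP=> m mC xC yC exy.
have mxy : matching (tperm x y) [set x; y].
  split=> z; first exact: tpermK.
    by rewrite !inE => /orP[] /eqP->; rewrite ?tpermL ?tpermR // e_sym.
  by rewrite !inE negb_or => /andP[zx zy]; rewrite tpermD // eq_sym.
have [_ _ mN] := mC.
have -> : [set x; y] :|: C = ([set x; y] :&: [set x; y]) :|: (C :\: [set x; y]).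
  by apply/setP=> z; rewrite !inE; case: eqP; case: eqP.
apply: (matchable_glue mxy mC) => z; rewrite !inE.
  by case/orP=> /eqP->; rewrite ?tpermL ?tpermR eqxx ?orbT.
by case/orP=> /eqP->; rewrite mN ?inE ?eqxx ?orbT.
Qed.

Lemma card_matching_augment C x y :
  matchable C -> x \notin C -> y \notin C -> e x y ->
  #|C| + (x != y).+1 <= matching_rank.
Proof.
move=> mC xC yC exy; have /leq_matching_rank := matchableU2 mC xC yC exy.
rewrite cardsU cards2 (_ : _ :&: C = set0) ?cards0 ?subn0 1?addnC //.
by apply/setP=> z; rewrite !inE; apply/negP => /andP[/orP[] /eqP-> ]; apply/negP.
Qed.

Lemma basis_compl_independent C x y : basis C -> x \notin C -> y \notin C -> ~~ e x y.
Proof.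
move=> /andP[mC /eqP rkC] xC yC; apply/negP => /(card_matching_augment mC xC yC).
by rewrite rkC addnS ltnNge leq_addr.
Qed.

Lemma matching_exchange_component m1 m2 C1 C2 v :
  matching m1 C1 -> matching m2 C2 -> #|C1| = matching_rank ->
  v \in C2 -> v \notin C1 ->
  exists Q z, [/\ {in Q, forall x, m1 x \in Q} /\ {in Q, forall x, m2 x \in Q},
    v \in Q, z \in Q, C1 :&: Q = Q :\ v & C2 :&: Q = Q :\ z].
Proof.
move=> matching1 matching2 rkC1 vC2 vC1.
have [[m1K _ m1N] [m2K _ m2N]] := (matching1, matching2).
have m1v : m1 v = v by rewrite m1N ?inE.
have [Q [vQ stable1 stable2 fix_eq]] := exists_stable_unique_fixpoint m1K m2K m1v.
have le_card : #|C2 :&: Q| <= #|C1 :&: Q|.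
  have := leq_matching_rank (matchable_glue matching2 matching1 stable2 stable1).
  rewrite -rkC1 -(cardsID Q C1) cardsU.
  have -> : C2 :&: Q :&: (C1 :\: Q) = set0.
    by apply/setP=> x; rewrite !inE; case: (x \in Q); rewrite ?andbF.
  by rewrite cards0 subn0 leq_add2r.
have C1Q_sub : C1 :&: Q \subset Q :\ v.
  by apply/subsetP=> x /setIP[xC1 xQ]; rewrite !inE xQ andbT; apply: contraNneq vC1 => <-.
have cardQ := cardsD1 v Q; rewrite vQ in cardQ.
have leC1Q := subset_leq_card C1Q_sub.
have [z zQ zC2] : exists2 z, z \in Q & z \notin C2.
  apply/subsetPn/negP => /setIidPr C2Q; rewrite C2Q in le_card; lia.
have C2Q : C2 :&: Q = Q :\ z.
  apply/setP=> x; rewrite !inE andbC; case xQ: (x \in Q); rewrite ?andbF //= andbT.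
  have [-> | neq_xz] := eqVneq x z; first exact: negbTE.
  apply: contraNT neq_xz => xC2; apply/eqP/fix_eq => //; first by rewrite m2N ?inE.
  by rewrite m2N ?inE.
exists Q, z; split=> //; apply/eqP; rewrite eqEcard C1Q_sub.
apply: leq_trans le_card; rewrite C2Q.
by have := cardsD1 z Q; rewrite zQ; lia.
Qed.

Lemma setIUsetD_swap C1 C2 Q x y :
  x \in Q -> y \in Q -> x != y -> C1 :&: Q = Q :\ x -> C2 :&: Q = Q :\ y ->
  (C1 :&: Q) :|: (C2 :\: Q) = y |: (C2 :\ x).
Proof.
move=> xQ yQ neq_xy -> C2Q; apply/setP=> a; have /setP/(_ a) := C2Q; rewrite !inE.
case aQ: (a \in Q); rewrite ?andbT ?andbF /= => aC2.
  by rewrite aC2; have [->|] := eqVneq a y; rewrite ?andbT ?orbF // eq_sym.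
have neq_ax : a != x by apply: contraFneq aQ => ->.
have neq_ay : a != y by apply: contraFneq aQ => ->.
by rewrite neq_ax (negPf neq_ay).
Qed.

Lemma basis_exchange C D v :
  basis C -> matchable D -> v \in D -> v \notin C ->
  exists z, [/\ z \in C, z \notin D, matchable (z |: (D :\ v))
              & matchable (v |: (C :\ z))].
Proof.
case/andP=> /matchableP[m1 matching1] /eqP rkC /matchableP[m2 matching2] vD vC.
have [Q [z [[stable1 stable2] vQ zQ C_Q D_Q]]] :=
  matching_exchange_component matching1 matching2 rkC vD vC.
have zD : z \notin D.
  by have /setP/(_ z) := D_Q; rewrite !inE zQ eqxx andbT => ->.
have neq_vz : v != z by apply: contraNneq zD => <-.
have neq_zv : z != v by rewrite eq_sym.
exists z; split=> //.
- by have /setP/(_ z) := C_Q; rewrite !inE zQ neq_zv andbT => ->.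
- by rewrite -(setIUsetD_swap vQ zQ _ C_Q D_Q) // (matchable_glue matching1 matching2).
- by rewrite -(setIUsetD_swap zQ vQ _ D_Q C_Q) // (matchable_glue matching2 matching1).
Qed.

Lemma cards_swap C x y : x \in C -> y \notin C -> #|y |: (C :\ x)| = #|C|.
Proof. by move=> xC yC; rewrite cardsU1 (cardsD1 x C) xC !inE (negPf yC) andbF. Qed.

Lemma basis_swap C D x y :
  basis C -> #|D| = #|C| -> x \in D -> y \notin D -> matchable (y |: (D :\ x)) ->
  basis (y |: (D :\ x)).
Proof. by rewrite /basis => /andP[_ /eqP<-] <- xD yD ->; rewrite cards_swap ?eqxx. Qed.

Section NoEssentialVertex.
Hypothesis no_essential : forall v, ~~ essential v.
Variable C : {set T}.
Hypothesis basisC : basis C.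

Let rankC : #|C| = matching_rank. Proof. by case/andP: basisC => _ /eqP. Qed.

Definition leaving x y : bool := [&& x \in C, y \notin C & e x y].

Lemma leaving_avoidable x y : leaving x y -> exists2 D, basis D & x \notin D.
Proof.
case/and3P=> xC yC exy; have := no_essential x; rewrite negb_forall_in.
case/exists_inP=> D /andP[mD xD]; rewrite -leqNgt => leD.
have neq_xy : x != y by apply: contraTneq xC => ->.
have not_avoid D' : matchable D' -> #|D'| = #|D| -> x \notin D' -> y \in D'.
  move=> mD' cardD' xD'; apply: contraT => yD'.
  by have := card_matching_augment mD' xD' yD' exy; rewrite neq_xy; lia.
have yD := not_avoid D mD erefl xD.
have [z [zC zD mDz mCz]] := basis_exchange basisC mD yD yC.
have [eq_zx | neq_zx] := eqVneq z x; last first.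
  have neq_yz : y != z by apply: contraNneq zD => <-.
  have := not_avoid _ mDz (cards_swap yD zD).
  rewrite !inE !negb_or !negb_and xD orbT eq_sym neq_zx (negPf neq_yz) eqxx.
  by move=> /(_ isT).
exists (y |: (C :\ z)); first exact: (basis_swap basisC).
by rewrite eq_zx !inE eqxx orbF.
Qed.

Lemma leaving_loopless x y : leaving x y -> ~~ e x x.
Proof.
by case/leaving_avoidable=> D basisD xD; exact: (basis_compl_independent basisD xD xD).
Qed.

Lemma leaving_unique x y y' : leaving x y -> leaving x y' -> y = y'.
Proof.
move=> lxy lxy'; have [D basisD xD] := leaving_avoidable lxy.
have [/and3P[xC yC exy] /and3P[_ yC' exy']] := (lxy, lxy').
have [mC _] := andP basisC; have [z [_ zC mCz _]] := basis_exchange basisD mC xC xD.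
have eq_z a : a \notin C -> e x a -> a = z.
  move=> aC exa; apply/eqP; apply: contraLR exa => neq_az.
  apply: (basis_compl_independent (basis_swap basisC erefl xC zC mCz)).
    by rewrite !inE eqxx orbF; apply: contraTneq xC => ->.
  by rewrite !inE negb_or neq_az (negPf aC) andbF.
by rewrite (eq_z y) // (eq_z y').
Qed.

Lemma edge_sub_or_leaving p :
  p \in edges -> p \subset C \/ exists2 xy, leaving xy.1 xy.2 & p = [set xy.1; xy.2].
Proof.
case/edgesP=> -[x y] /= exy ->; rewrite subUset !sub1set.
have [xC|xC] := boolP (x \in C); have [yC|yC] := boolP (y \in C).
- by left.
- by right; exists (x, y) => //; apply/and3P.
- by right; exists (y, x); rewrite /= 1?setUC // /leaving yC xC e_sym.
- by have := basis_compl_independent basisC xC yC; rewrite exy.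
Qed.

Lemma leaving_setI x y : leaving x y -> [set x; y] :&: C = [set x].
Proof.
case/and3P=> xC yC _; apply/setP=> a; rewrite !inE.
have [->|_] := eqVneq a x; first by rewrite xC.
by have [->|//] := eqVneq a y; apply: negbTE.
Qed.

Lemma edge_setI_inj : {in edges &, injective (fun p => p :&: C)}.
Proof.
have sub_neq_leaving p x y : p \in edges -> p \subset C -> leaving x y -> p <> [set x].
  move=> pE pC /leaving_loopless loopless Ep.
  by move: pE; rewrite Ep -[X in X \in _]setUid mem_edges (negPf loopless).
move=> p q pE qE /=.
have [pC | [[x y] /= lxy Ep]] := edge_sub_or_leaving pE;
  have [qC | [[x' y'] /= lxy' Eq]] := edge_sub_or_leaving qE.
- by rewrite (setIidPl pC) (setIidPl qC).
- by rewrite (setIidPl pC) Eq leaving_setI // => /(sub_neq_leaving _ _ _ pE pC lxy').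
- rewrite (setIidPl qC) Ep leaving_setI // => /esym.
  by move=> /(sub_neq_leaving _ _ _ qE qC lxy).
rewrite Ep Eq !leaving_setI // => /set1_inj eq_xx'.
by rewrite -eq_xx' in lxy' *; rewrite (leaving_unique lxy lxy').
Qed.

Lemma card_edges_no_essential : #|edges| <= 'C(matching_rank.+1, 2).
Proof.
pose draws i := [set p : {set T} | p \subset C & #|p| == i].
rewrite -(card_in_imset edge_setI_inj) -rankC binS -(cards_draws C 2) -(cards_draws C 1).
apply: leq_trans (leq_card_setU (draws 2) (draws 1)).
apply/subset_leq_card/subsetP=> _ /imsetP[p pE ->]; rewrite !inE subsetIr /=.
have [[x y] exy Ep] := edgesP _ pE.
have : #|p :&: C| <= 2.
  by apply: leq_trans (subset_leq_card (subsetIl _ _)) _; rewrite Ep cards2; case: eqP.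
suff : 0 < #|p :&: C| by lia.
have [/setIidPl-> | [xy lxy ->]] := edge_sub_or_leaving pE.
  by rewrite Ep cards2.
by rewrite leaving_setI ?cards1.
Qed.

End NoEssentialVertex.
End Matchings.

Definition delete_vertex (T : finType) (e : rel T) (v : T) : rel T :=
  [rel x y | [&& e x y, x != v & y != v]].

Lemma delete_vertex_sym (T : finType) (e : rel T) (v : T) :
  symmetric e -> symmetric (delete_vertex e v).
Proof. by move=> e_sym x y; rewrite /delete_vertex /= e_sym andbA andbAC -andbA. Qed.

Lemma matching_rank_delete_essential (T : finType) (e : rel T) (v : T) (C : {set T}) :
  essential e v -> matchable (delete_vertex e v) C -> #|C|.+2 <= matching_rank e.
Proof.
move=> /forall_inP ess /matchableP[m [mK mC mN]]; apply: ess; apply/andP; split.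
  by apply/matchableP; exists m; split=> // x /mC /and3P[].
by apply/negP => /mC /and3P[_]; rewrite eqxx.
Qed.

Lemma card_edges_delete_vertex (T : finType) (e : rel T) (v : T) (W : {set T}) :
  symmetric e -> (forall x y, e x y -> x \in W) ->
  #|edges e| <= #|edges (delete_vertex e v)| + #|W|.
Proof.
move=> e_sym eW; pose star := [set [set v; x] | x in W].
apply: leq_trans (_ : _ <= #|edges (delete_vertex e v)| + #|star|) _; last first.
  by rewrite leq_add2l leq_imset_card.
apply: leq_trans (leq_card_setU _ _).
apply/subset_leq_card/subsetP=> _ /edgesP[[x y] /= exy ->]; rewrite inE.
have [-> | neq_xv] := eqVneq x v.
  by apply/orP; right; apply/imsetP; exists y => //; apply: (eW y x); rewrite e_sym.
have [-> | neq_yv] := eqVneq y v.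
  by apply/orP; right; apply/imsetP; exists x; [apply: (eW x y) | rewrite setUC].
by rewrite mem_edges; [apply/orP; left; apply/and3P | apply: delete_vertex_sym].
Qed.

Lemma card_edges_matching_rank (k : nat) (T : finType) (e : rel T) (W : {set T}) :
  symmetric e -> (forall x y, e x y -> x \in W) -> matching_rank e <= k ->
  exists2 a, 2 * a <= k & #|edges e| + 'C(a, 2) <= a * #|W| + 'C(k.+1 - 2 * a, 2).
Proof.
elim/ltn_ind: k => k IHk in e W *; move=> e_sym eW le_rk.
have [C basisC] := basis_exists e.
have [/existsP[v ess] | no_ess] := boolP [exists v, essential e v]; last first.
  exists 0; rewrite // bin0n addn0 mul0n muln0 subn0.
  apply: leq_trans (leq_bin2l 2 (_ : (matching_rank e).+1 <= k.+1)) => //.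
  apply: (card_edges_no_essential e_sym _ basisC) => v.
  by apply: contra no_ess => ess; apply/existsP; exists v.
have rk2 : 2 <= matching_rank e.
  rewrite -[2]/(0.+2) -(cards0 T).
  exact: (matching_rank_delete_essential ess (matchable0 _)).
have vW : v \in W.
  have /andP[/matchableP[m [_ mC _]] _] := basisC.
  exact: eW (mC v (essential_mem_basis ess basisC)).
have [||||a le_a bound] := IHk (k - 2) _ (delete_vertex e v) (W :\ v).
- lia.
- exact: delete_vertex_sym.
- by move=> x y /and3P[/eW xW neq_xv _]; rewrite !inE xW neq_xv.
- by apply/bigmax_leqP => D /(matching_rank_delete_essential ess); lia.
exists a.+1; first by lia.
have := card_edges_delete_vertex v e_sym eW; have := cardsD1 v W; rewrite vW.
have -> : k.+1 - 2 * a.+1 = (k - 2).+1 - 2 * a by lia.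
by rewrite binS bin1; nia.
Qed.

Lemma mul2_bin2 p : 'C(p, 2) * 2 + p = p * p.
Proof. by elim: p => // p IHp; rewrite binS bin1 mulnDl; lia. Qed.

Lemma u_sE n k : u_s n k = maxn 'C(k.+1, 2) (k./2 * n - 'C(k./2, 2) + odd k).
Proof.
have kE : k = odd k + 2 * k./2 by rewrite mul2n odd_double_half.
by rewrite /u_s; case: (odd k) kE => kE; congr (maxn 'C(_, 2) _); lia.
Qed.

(* The bound is convex in [a], hence largest at [a = 0] or [a = k./2]. *)
Lemma leq_u_s (n k a d : nat) :
  k <= n -> 2 * a <= k ->
  d + 'C(a, 2) <= a * n + 'C(k.+1 - 2 * a, 2) -> d <= u_s n k.
Proof.
move=> le_kn le_ak; rewrite u_sE leq_max.
have kE : k = odd k + 2 * k./2 by rewrite mul2n odd_double_half.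
move: (odd k : nat) (leq_b1 (odd k)) (k./2) kE => o le_o1 t kE.
have o_idem : o * o = o by case: o le_o1 {kE} => [|[]].
have [b tE] : exists b, t = a + b by exists (t - a); lia.
have [q qE] : exists q, q = k.+1 - 2 * a by exists (k.+1 - 2 * a).
have := mul2_bin2 a; have := mul2_bin2 t; have := mul2_bin2 k.+1; have := mul2_bin2 q.
rewrite -qE => bin_q bin_k bin_t bin_a le_d; apply/orP.
have [le_n | lt_n] := leqP (2 * n + 3 * a) (8 * t + 4 * o + 1); [left | right].
  have : a * (2 * n + 3 * a + 3) <= a * (4 * q + 8 * a) by rewrite leq_mul2l; lia.
  have k_q : k.+1 = q + 2 * a by lia.
  rewrite k_q in bin_k *; lia.
have le_tn : t * t <= t * n by rewrite leq_mul2l; lia.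
have : b * (8 * t + 4 * o + 2) <= b * (2 * n + 3 * a) by rewrite leq_mul2l; lia.
have q_o : q = o + 2 * b + 1 by lia.
rewrite q_o in bin_q le_d; rewrite tE in bin_t le_tn *; lia.
Qed.

Lemma big_option (R : Type) (idx : R) (op : Monoid.com_law idx) (T : finType)
    (f : option T -> R) :
  \big[op/idx]_o f o = op (f None) (\big[op/idx]_x f (Some x)).
Proof.
rewrite (bigD1 None) //= (reindex_omap (Some : T -> option T) id) => [|[]//].
by congr (op _ _); apply: eq_bigl => x; rewrite eqxx.
Qed.

Lemma big_fibers (R : Type) (idx : R) (op : Monoid.com_law idx) (I J : finType)
    (u : I -> J) (h : J -> R) :
  \big[op/idx]_i h (u i)
  = \big[op/idx]_j iter #|u @^-1: [set j]| (op (h j)) idx.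
Proof.
rewrite (partition_big u xpredT) //=; apply: eq_bigr => j _.
by rewrite -big_const; apply: eq_big => [i | i /eqP->] //; rewrite !inE.
Qed.

Lemma sum_nat_fibers (I J : finType) (u : I -> J) (h : J -> nat) :
  \sum_i h (u i) = \sum_j #|u @^-1: [set j]| * h j.
Proof. by rewrite big_fibers; apply: eq_bigr => j _; rewrite iter_addn_0 mulnC. Qed.

Lemma card_fibers (I J : finType) (u : I -> J) : \sum_j #|u @^-1: [set j]| = #|I|.
Proof.
by rewrite -sum1_card (sum_nat_fibers u (fun=> 1)); apply: eq_bigr => j _; rewrite muln1.
Qed.

Lemma option_fibers_dominating (I J : finType) (u : I -> option J) (r : I -> J) :
  (forall j, #|r @^-1: [set j]| <= #|u @^-1: [set Some j]|) ->
  exists2 s : I -> J, forall i, u i = Some (s i)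
    & forall j, #|s @^-1: [set j]| = #|r @^-1: [set j]|.
Proof.
move=> le_ru; have sum_u : #|u @^-1: [set None]| + \sum_j #|u @^-1: [set Some j]|
    = \sum_j #|r @^-1: [set j]|.
  by rewrite (card_fibers r) -(card_fibers u) big_option.
have le_sum : \sum_j #|r @^-1: [set j]| <= \sum_j #|u @^-1: [set Some j]|.
  by apply: leq_sum => j _; apply: le_ru.
have /cards0_eq/setP no_None : #|u @^-1: [set None]| = 0 by lia.
have u_Some i : exists j, u i = Some j.
  by case ui: (u i) => [j|]; [exists j | have := no_None i; rewrite !inE ui].
have [s us] := fin_all_exists u_Some; exists s => // j.
have fiber_us : #|s @^-1: [set j]| = #|u @^-1: [set Some j]|.
  by apply: eq_card => i; rewrite !inE us (inj_eq Some_inj).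
have [_] := leqif_sum (fun j (_ : xpredT j) => leqif_eq (le_ru j)).
have -> : \sum_j #|r @^-1: [set j]| = \sum_j #|u @^-1: [set Some j]| by lia.
by rewrite eqxx fiber_us => /esym/forallP/(_ j)/eqP.
Qed.

Local Open Scope ring_scope.

Lemma prod_fibers (R : comPzSemiRingType) (I J : finType) (u : I -> J) (h : J -> R) :
  \prod_i h (u i) = \prod_j h j ^+ #|u @^-1: [set j]|.
Proof. by rewrite big_fibers; apply: eq_bigr => j _; rewrite iter_mulr_1. Qed.

Section Nonvanishing.
Variables (F : fieldType) (N : nat) (pt : 'I_N -> F).
Hypothesis pt_inj : injective pt.

Lemma Vandermonde_unitmx : Vandermonde N (\row_i pt i) \in unitmx.
Proof.
rewrite unitmxE unitfE det_Vandermonde; apply/prodf_neq0 => i _.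
apply/prodf_neq0 => j lt_ij; rewrite !mxE subr_eq0 (inj_eq pt_inj).
by apply: contraTneq lt_ij => ->; rewrite ltnn.
Qed.

Lemma exists_coefficient_functional (d : 'I_N) :
  exists om : 'I_N -> F, forall m : 'I_N, \sum_j om j * pt j ^+ m = (m == d)%:R.
Proof.
set V := Vandermonde N (\row_i pt i).
exists (fun j => (invmx V *m delta_mx d (ord0 : 'I_1)) j ord0) => m.
transitivity ((V *m (invmx V *m delta_mx d (ord0 : 'I_1))) m ord0).
  by rewrite mxE; apply: eq_bigr => j _; rewrite !mxE mulrC.
by rewrite mulKVmx ?Vandermonde_unitmx // mxE eqxx andbT.
Qed.

(* The product over [l] of the functionals extracting the coefficient of degree
   [e i0 l] in the variable [l] kills every term but the one of index [i0]. *)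
Lemma maximal_term_exists_eval_neq0 (I L : finType) (c : I -> F)
    (e : I -> L -> nat) (i0 : I) :
  c i0 != 0 -> (forall l, (e i0 l < N)%N) ->
  (forall i, c i != 0 -> (forall l, (e i0 l <= e i l)%N) -> i = i0) ->
  exists x : L -> 'I_N, \sum_i c i * \prod_l pt (x l) ^+ e i l != 0.
Proof.
move=> c_i0 lt_e max_i0.
have [om omE] :=
  fin_all_exists (fun l => exists_coefficient_functional (Ordinal (lt_e l))).
have [/existsP[x x_neq0]|] := boolP [exists x : {ffun L -> 'I_N},
    \sum_i c i * \prod_l pt (x l) ^+ e i l != 0]; first by exists x.
rewrite negb_exists => /forallP vanish; case/eqP: c_i0.
have functionalE i : \sum_(x : {ffun L -> 'I_N})
    (\prod_l om l (x l)) * (c i * \prod_l pt (x l) ^+ e i l) =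
    c i * \prod_l \sum_j om l j * pt j ^+ e i l.
  rewrite bigA_distr_bigA big_distrr; apply: eq_bigr => x _ /=.
  by rewrite big_split mulrCA.
have : \sum_(x : {ffun L -> 'I_N})
    (\prod_l om l (x l)) * \sum_i c i * \prod_l pt (x l) ^+ e i l = 0.
  by apply: big1 => x _; have /negPn/eqP-> := vanish x; rewrite mulr0.
under eq_bigr do rewrite big_distrr /=.
rewrite exchange_big (eq_bigr _ (fun i _ => functionalE i)) (bigD1 i0) //=.
rewrite [\prod_l _]big1 => [|l _]; last by rewrite (omE l (Ordinal (lt_e l))) eqxx.
rewrite mulr1 big1 ?addr0 // => i neq_i; apply/eqP; apply: contraNT neq_i.
rewrite mulf_eq0 negb_or => /andP[c_i prod_neq0]; apply/eqP/max_i0 => // l.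
rewrite leqNgt; apply: contra prod_neq0 => lt_el; apply/eqP.
have lt_N := ltn_trans lt_el (lt_e l).
by rewrite (bigD1 l) //= (omE l (Ordinal lt_N)) -val_eqE /= ltn_eqF // mul0r.
Qed.

End Nonvanishing.

Lemma det_sum (R : comPzRingType) (n : nat) (J : finType) (c : J -> R)
    (Y : J -> 'M[R]_n) :
  \det (\sum_j c j *: Y j) =
  \sum_(su : 'S_n * {ffun 'I_n -> J})
    (-1) ^+ su.1 * \prod_i Y (su.2 i) i (su.1 i) * \prod_j c j ^+ #|su.2 @^-1: [set j]|.
Proof.
rewrite /determinant -(pair_bigA _ (fun (s : 'S_n) (u : {ffun 'I_n -> J}) =>
  (-1) ^+ s * \prod_i Y (u i) i (s i) * \prod_j c j ^+ #|u @^-1: [set j]|)) /=.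
apply: eq_bigr => s _; under eq_bigr do rewrite summxE.
rewrite bigA_distr_bigA big_distrr; apply: eq_bigr => u _ /=.
rewrite -prod_fibers -mulrA -big_split; congr (_ * _); apply: eq_bigr => i _.
by rewrite mxE mulrC.
Qed.

Lemma det_affine_sum (R : comPzRingType) (n : nat) (L : finType) (A : 'M[R]_n)
    (X : L -> 'M[R]_n) (x : L -> R) :
  \det (A + \sum_l x l *: X l) =
  \sum_(su : 'S_n * {ffun 'I_n -> option L})
    (-1) ^+ su.1 * \prod_i (if su.2 i is Some l then X l else A) i (su.1 i)
    * \prod_l x l ^+ #|su.2 @^-1: [set Some l]|.
Proof.
pose c o := if o is Some l then x l else 1.
pose Y o := if o is Some l then X l else A.
have -> : A + \sum_l x l *: X l = \sum_o c o *: Y o by rewrite big_option scale1r.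
by rewrite det_sum; apply: eq_bigr => su _; rewrite big_option /= expr1n mul1r.
Qed.

Section LeadingEntries.
Variables (R : pzSemiRingType) (n : nat) (w : 'I_n -> nat).
Implicit Types (X : 'M[R]_n).

Definition weight X : nat := \max_(p | X p.1 p.2 != 0) (w p.1 + w p.2)%N.

Definition leading X (i j : 'I_n) : bool :=
  (X i j != 0) && (w i + w j == weight X)%N.

Lemma leq_weight X i j : X i j != 0 -> (w i + w j <= weight X)%N.
Proof. exact: (leq_bigmax_cond (i, j)). Qed.

Lemma leadingP X i j :
  reflect (X i j != 0 /\ forall i' j', X i' j' != 0 -> (w i' + w j' <= w i + w j)%N)
          (leading X i j).
Proof.
apply: (iffP andP) => [[Xij /eqP->] | [Xij max_ij]].
  by split=> // *; apply: leq_weight.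
split=> //; rewrite eqn_leq leq_weight //; apply/bigmax_leqP => -[i' j'] /=.
exact: max_ij.
Qed.

Lemma leading_exists X : X != 0 -> exists i j, leading X i j.
Proof.
case/matrix0Pn=> i [j Xij]; have [|p Xp wE] :=
    @eq_bigmax_cond _ (fun p => X p.1 p.2 != 0) (fun p => (w p.1 + w p.2)%N).
  by apply/card_gt0P; exists (i, j).
by exists p.1, p.2; apply/andP; split; [exact: Xp | rewrite /weight wE].
Qed.

End LeadingEntries.

Lemma leading_mxsub (R : pzSemiRingType) (n m : nat) (f : 'I_m -> 'I_n) (w : 'I_n -> nat)
    (X : 'M[R]_n) (i j : 'I_m) :
  leading w X (f i) (f j) -> leading (w \o f) (mxsub f f X) i j.
Proof.
move=> /leadingP[Xij max_ij]; apply/leadingP; rewrite mxE; split=> // i' j'.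
by rewrite mxE; apply: max_ij.
Qed.

Section DeterminantLeadingTerm.
Variables (F : fieldType) (n : nat) (L : finType) (w : 'I_n -> nat).
Variables (r : 'I_n -> L) (phi : 'S_n) (X : L -> 'M[F]_n).
Hypothesis leadingX :
  forall k i j, leading w (X (r k)) i j = (r i == r k) && (j == phi i).

Let leading_phi i : leading w (X (r i)) i (phi i).
Proof. by rewrite leadingX !eqxx. Qed.

(* The weights of the entries are at most those of the matrices they are taken
   from, and have the same sum. *)
Lemma leading_term_unique (s : 'S_n) (k : 'I_n -> L) :
  (forall i, X (k i) i (s i) != 0) ->
  (forall l, #|k @^-1: [set l]| = #|r @^-1: [set l]|) -> s = phi /\ k =1 r.
Proof.
move=> entry_neq0 fibers_k.
have sum_perm (t : 'S_n) :
    (\sum_i (w i + w (t i)) = \sum_i w i + \sum_i w i)%N.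
  rewrite big_split /=; congr addn.
  by rewrite [RHS](reindex_inj (@perm_inj _ t)).
have sum_weight : (\sum_i (w i + w (s i)) = \sum_i weight w (X (k i)))%N.
  rewrite (sum_nat_fibers k (fun l => weight w (X l))).
  under [RHS]eq_bigr do rewrite fibers_k.
  rewrite -(sum_nat_fibers r (fun l => weight w (X l))) sum_perm -(sum_perm phi).
  by apply: eq_bigr => i _; case/andP: (leading_phi i) => _ /eqP.
have leading_s i : leading w (X (k i)) i (s i).
  have [_] := leqif_sum (fun a (_ : xpredT a) => leqif_eq (leq_weight w (entry_neq0 a))).
  by rewrite sum_weight eqxx /leading entry_neq0 => /esym/forallP/(_ i).
have k_codom i : exists i', k i = r i'.
  have : (0 < #|k @^-1: [set k i]|)%N by apply/card_gt0P; exists i; rewrite !inE.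
  by rewrite fibers_k => /card_gt0P[i']; rewrite !inE => /eqP; exists i'.
have eq_entry i : k i = r i /\ s i = phi i.
  have := leading_s i; have [i' ->] := k_codom i.
  by rewrite leadingX => /andP[/eqP<- /eqP].
by split=> [|i]; [apply/permP => i | ]; case: (eq_entry i).
Qed.

Lemma exists_det_neq0 (N : nat) (pt : 'I_N -> F) (A : 'M[F]_n) :
  injective pt -> (forall l, (#|r @^-1: [set l]| < N)%N) ->
  exists x : L -> F, \det (A + \sum_l x l *: X l) != 0.
Proof.
move=> pt_inj lt_N.
pose c (su : 'S_n * {ffun 'I_n -> option L}) :=
  (-1) ^+ su.1 * \prod_i (if su.2 i is Some l then X l else A) i (su.1 i).
pose e (su : 'S_n * {ffun 'I_n -> option L}) l := #|su.2 @^-1: [set Some l]|.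
pose su0 : 'S_n * {ffun 'I_n -> option L} := (phi, [ffun i => Some (r i)]).
have e_su0 l : e su0 l = #|r @^-1: [set l]|.
  by apply: eq_card => i; rewrite !inE ffunE (inj_eq Some_inj).
have [|l||x det_neq0] := @maximal_term_exists_eval_neq0 F N pt pt_inj _ L c e su0.
- rewrite mulf_neq0 ?signr_eq0 //; apply/prodf_neq0 => i _.
  by rewrite ffunE; case/andP: (leading_phi i).
- by rewrite e_su0.
- move=> [s u]; rewrite mulf_eq0 negb_or signr_eq0 => /prodf_neq0 /= entry_neq0 le_e.
  have [|k uE fibers_k] := @option_fibers_dominating _ _ u r.
    by move=> l; rewrite -e_su0 le_e.
  have [|-> kr] := @leading_term_unique s k _ fibers_k.
    by move=> i; have := entry_neq0 i isT; rewrite uE.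
  by congr pair; apply/ffunP => i; rewrite ffunE uE kr.
by exists (pt \o x); rewrite det_affine_sum.
Qed.

End DeterminantLeadingTerm.

Lemma leading_sym (F : fieldType) (n : nat) (w : 'I_n -> nat) (X : 'M[F]_n) (i j : 'I_n) :
  weakly_symmetric X -> leading w X i j -> leading w X j i.
Proof. by move=> X_sym /andP[/X_sym Xji]; rewrite addnC /leading Xji. Qed.

Definition sidon (I : Type) (w : I -> nat) : Prop :=
  forall a b c d, (w a + w b = w c + w d)%N -> (a = c /\ b = d) \/ (a = d /\ b = c).

Lemma sidon_comp (I J : Type) (w : J -> nat) (f : I -> J) :
  injective f -> sidon w -> sidon (w \o f).
Proof. by move=> f_inj sidon_w a b c d /sidon_w[][/f_inj-> /f_inj->]; auto. Qed.

Lemma sidon_expn2 : sidon (expn 2).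
Proof.
have lt_top x y z t : (x <= y)%N -> (y < t)%N -> (2 ^ x + 2 ^ y < 2 ^ z + 2 ^ t)%N.
  move=> le_xy lt_yt; have := leq_pexp2l (isT : (0 < 2)%N) le_xy.
  have := leq_pexp2l (isT : (0 < 2)%N) lt_yt; rewrite expnS.
  by have := expn_gt0 2 z; lia.
have sorted_inj x y z t : (x <= y)%N -> (z <= t)%N ->
    (2 ^ x + 2 ^ y = 2 ^ z + 2 ^ t)%N -> x = z /\ y = t.
  move=> le_xy le_zt sumE; have eq_yt : y = t.
    case: (ltngtP y t) => // [/(lt_top x y z t le_xy) | /(lt_top z t x y le_zt)].
      by rewrite sumE ltnn.
    by rewrite sumE ltnn.
  split=> //; apply: (@expnI 2) => //.
  by move: sumE; rewrite eq_yt => /addIn.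
move=> a b c d sumE.
case: (leqP a b) => [le_ab | /ltnW le_ba]; case: (leqP c d) => [le_cd | /ltnW le_dc].
- by left; apply: sorted_inj.
- by right; apply: sorted_inj; rewrite // sumE addnC.
- by right; have [] := sorted_inj _ _ _ _ le_ba le_cd; rewrite // addnC.
- by left; have [] := sorted_inj _ _ _ _ le_ba le_dc; rewrite // addnC sumE addnC.
Qed.

Lemma leading_sidon_unique (R : pzSemiRingType) (n : nat) (w : 'I_n -> nat) (X : 'M[R]_n)
    (i j k l : 'I_n) :
  sidon w -> leading w X i j -> leading w X k l -> (i = k /\ j = l) \/ (i = l /\ j = k).
Proof.
move=> sidon_w /andP[_ /eqP weight_ij] /andP[_ /eqP weight_kl].
by apply: sidon_w; rewrite weight_ij.
Qed.

(* Each pair [{i, phi i}] is represented by its minimum, so that it carries only one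
   of the matrices [X i] and [X (phi i)]. *)
Lemma exists_det_neq0_involutive (F : fieldType) (N : nat) (pt : 'I_N -> F) (n : nat)
    (w : 'I_n -> nat) (phi : 'I_n -> 'I_n) (A : 'M[F]_n) (X : 'I_n -> 'M[F]_n) :
  injective pt -> (2 < N)%N -> sidon w -> involutive phi ->
  (forall i, weakly_symmetric (X i)) -> (forall i, leading w (X i) i (phi i)) ->
  exists x : 'I_n -> F, \det (A + \sum_l x l *: X l) != 0.
Proof.
move=> pt_inj N_gt2 sidon_w phiK X_sym leading_phi.
pose r i := Order.min i (phi i).
have r_cases i : r i = i \/ r i = phi i by rewrite /r; case: leP; auto.
have r_phi i : r (phi i) = r i by rewrite /r phiK minC.
have r_idem i : r (r i) = r i by case: (r_cases i) => {1}->.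
apply: (@exists_det_neq0 _ _ _ w r (perm (inv_inj phiK)) X _ N pt A pt_inj) => [k i j|l].
  rewrite permE; apply/idP/andP => [leading_ij | [/eqP ri /eqP->]].
    have [[-> ->] | [-> ->]] :=
        leading_sidon_unique sidon_w leading_ij (leading_phi (r k)).
      by rewrite r_idem.
    by rewrite r_phi r_idem phiK.
  rewrite -ri; case: (r_cases i) => ->; first exact: leading_phi.
  by apply: leading_sym (X_sym _) _; have := leading_phi (phi i); rewrite phiK.
apply: leq_ltn_trans N_gt2; apply: leq_trans (_ : #|[set l; phi l]| <= 2)%N.
  apply/subset_leq_card/subsetP => i; rewrite !inE => /eqP <-.
  by case: (r_cases i) => ->; rewrite ?phiK eqxx ?orbT.
by rewrite cards2; case: eqP.
Qed.

(* Passing to the matrices of [B] that vanish at a leading position lowers the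
   dimension by at most 1, and no such matrix leads at that position. *)
Lemma exists_leading_graph (F : fieldType) (n : nat) (w : 'I_n -> nat)
    (B : {vspace 'M[F]_n}) :
  (forall X, X \in B -> weakly_symmetric X) ->
  exists e : rel 'I_n, [/\ symmetric e, (\dim B <= #|edges e|)%N
    & forall i j, e i j -> exists2 X, X \in B & leading w X i j].
Proof.
have := leqnn (\dim B); move: {1 3}(\dim B) => d.
elim: d => [|d IHd] in B * => le_d B_sym; first by exists (fun _ _ => false).
have B_neq0 : vpick B != 0 by rewrite vpick0 -dimv_eq0 -lt0n (leq_ltn_trans _ le_d).
have [i [j leading_ij]] := leading_exists w B_neq0.
pose entry : 'Hom('M[F]_n, 'M[F]_1) := linfun (mxsub (fun=> i) (fun=> j)).
have le_d_ker : (d <= \dim (B :&: lker entry))%N.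
  rewrite -ltnS (leq_trans le_d) // -(limg_ker_dim entry B).
  rewrite -[X in (_ <= X)%N]addn1 leq_add2l.
  by apply: leq_trans (dimvS (subvf _)) _; rewrite dimvf.
have [X|e [e_sym le_edges leading_e]] := IHd _ le_d_ker.
  by rewrite memv_cap => /andP[/B_sym].
have not_eij : ~~ e i j.
  apply/negP => /leading_e[Y]; rewrite memv_cap memv_ker lfunE => /andP[_ /eqP entryY0].
  by case/andP; have /matrixP/(_ 0 0) := entryY0; rewrite !mxE => ->; rewrite eqxx.
pose e' := [rel a b | e a b || ([set a; b] == [set i; j])].
have e'_sym : symmetric e' by move=> a b /=; rewrite e_sym setUC.
exists e'; split=> // [|a b /orP[/leading_e[X] | /eqP/set2_inj eq_ab]].
- have not_edge : [set i; j] \notin edges e by rewrite mem_edges.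
  apply: leq_trans (_ : #|[set i; j] |: edges e| <= _)%N.
    by rewrite cardsU1 not_edge.
  apply/subset_leq_card/subsetP=> p; rewrite !inE => /orP[/eqP-> | ].
    by rewrite mem_edges //= eqxx orbT.
  by case/edgesP=> -[a b] eab ->; rewrite mem_edges //= eab.
- by rewrite memv_cap => /andP[XB _]; exists X.
exists (vpick B); first exact: memv_pick.
case: eq_ab => [[-> ->] // | [-> ->]].
by apply: leading_sym => //; apply/B_sym/memv_pick.
Qed.

Lemma mxrank_mxsub (F : fieldType) (m n m' n' : nat) (f : 'I_m' -> 'I_m)
    (g : 'I_n' -> 'I_n) (A : 'M[F]_(m, n)) : (\rank (mxsub f g A) <= \rank A)%N.
Proof.
rewrite -[A in mxsub _ _ A]mulmx1 mxsub_mul.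
exact: leq_trans (mxrankM_maxl _ _) (mxrankS (rowsub_sub f A)).
Qed.

Lemma leq_rank_matchable (F : fieldType) (N : nat) (pt : 'I_N -> F) (n : nat)
    (w : 'I_n -> nat) (A : 'M[F]_n) (B : {vspace 'M[F]_n}) (e : rel 'I_n)
    (C : {set 'I_n}) :
  injective pt -> (2 < N)%N -> sidon w -> (forall X, X \in B -> weakly_symmetric X) ->
  (forall i j, e i j -> exists2 X, X \in B & leading w X i j) -> matchable e C ->
  exists2 M, affine_space A B M & (#|C| <= \rank M)%N.
Proof.
move=> pt_inj N_gt2 sidon_w B_sym leading_e /matchableP[m M].
have [mK mC _] := M; pose f : 'I_#|C| -> 'I_n := enum_val.
have f_inj : injective f := enum_val_inj.
pose phi i := enum_rank_in (enum_valP i) (m (f i)).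
have f_phi i : f (phi i) = m (f i).
  by rewrite /f enum_rankK_in // (matching_mem _ M) enum_valP.
have phiK : involutive phi by move=> i; apply: f_inj; rewrite !f_phi mK.
have [X XB leadingX] := fin_all_exists2 (fun i => leading_e _ _ (mC _ (enum_valP i))).
have [||i|i|x det_neq0] := @exists_det_neq0_involutive F N pt _ (w \o f) phi
    (mxsub f f A) (fun i => mxsub f f (X i)) pt_inj N_gt2.
- exact: sidon_comp.
- exact: phiK.
- by move=> a b; rewrite !mxE; apply: B_sym.
- by apply: leading_mxsub; rewrite f_phi.
exists (A + \sum_l x l *: X l).
  by exists (\sum_l x l *: X l) => //; apply: memv_suml => l _; apply: memvZ.
apply: leq_trans (mxrank_mxsub f f _); rewrite linearD linear_sum.
under eq_bigr do rewrite linearZ /=.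
by rewrite mxrank_unit // unitmxE unitfE.
Qed.

Theorem theorem1p5 (F : fieldType) (hF : exists s : 3.-tuple F, uniq s)
    (n : nat) (A : 'M[F]_n) (B : {vspace 'M[F]_n})
    (hB : forall X : 'M[F]_n, X \in B -> weakly_symmetric X)
    (k : nat) (hk : max_rank_eq (affine_space A B) k) :
  (\dim B <= u_s n k)%N.
Proof.
have [s /tuple_uniqP pt_inj] := hF; have [[M _ rankM] le_k] := hk.
pose w (i : 'I_n) := (2 ^ i)%N.
have sidon_w : sidon w := sidon_comp val_inj sidon_expn2.
have [e [e_sym le_edges leading_e]] := exists_leading_graph w hB.
have le_rank : (matching_rank e <= k)%N.
  apply/bigmax_leqP => C mC.
  have [M' AB_M'] := leq_rank_matchable A pt_inj isT sidon_w hB leading_e mC.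
  by move/leq_trans; apply; apply: le_k.
have [|a le_ak bound] := @card_edges_matching_rank k _ e setT e_sym _ le_rank.
  by move=> x y _; rewrite inE.
rewrite cardsT card_ord in bound.
apply: leq_trans le_edges (leq_u_s _ le_ak bound).
by rewrite -rankM rank_leq_row.
Qed.
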